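(* Let $S$ be a self-similar IFS of $\mathbb{R}^d$, let $K$ be the attractor of $S$, and let $\mu$ be a self-similar measure associated with $S$. For any $0\le s<\dim(\mu)$, there exists a constant $c=c(d,\mu,s)>0$, depending on $d$, $\mu$ and $s$ only, such that for any ball $B=B(x,r)$ centered on $K$ with $r\le1$ and any open set $\Omega$, one has $$c(d,\mu,s)|B|^s\le\mathcal{H}^{\mu,s}_\infty(\mathring{B})\le\mathcal{H}^{\mu,s}_\infty(B)\le|B|^s$$ and $$c(d,\mu,s)\,\mathcal{H}^s_\infty(\Omega\cap K)\le\mathcal{H}^{\mu,s}_\infty(\Omega)\le\mathcal{H}^s_\infty(\Omega\cap K).$$ For any $s>\dim(\mu)$ and any open set $\Omega$, $\mathcal{H}^{\mu,s}_\infty(\Omega)=0$.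
   Context: $\mathbb{R}^d$ is endowed with $\|\cdot\|_\infty$; $B(x,r)$ is the closed ball, $|B|$ the diameter, $\mathring{B}$ the interior. A self-similar IFS is a family $S=\{f_i\}_{i=1}^m$ of $m\ge2$ contracting similarities of $\mathbb{R}^d$ (no separation condition is assumed); its attractor is the unique non-empty compact $K$ with $K=\bigcup_if_i(K)$. Given a probability vector $(p_i)\in(0,1)^m$, the associated self-similar measure is the unique probability measure with $\mu=\sum_ip_i\,\mu\circ f_i^{-1}$. Self-similar measures are exact dimensional: $\lim_{r\to0^+}\frac{\log\mu(B(x,r))}{\log r}$ exists and equals a constant $\dim(\mu)$ for $\mu$-a.e. $x$. $\mathcal{H}^s_\infty(E)=\inf\{\sum_n|L_n|^s:L_n\text{ closed balls},\ E\subset\bigcup_nL_n\}$ is the Hausdorff content, and for a Borel set $A$, the $\mu$-essential Hausdorff content is $\mathcal{H}^{\mu,s}_\infty(A)=\inf\{\mathcal{H}^s_\infty(E):E\subset A\text{ Borel},\ \mu(E)=\mu(A)\}$. *)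

(* Defs.v *)
From HB Require Import structures.
From mathcomp Require Import all_boot all_order all_algebra.
From mathcomp Require Import all_classical all_reals all_analysis.

Set Implicit Arguments.
Unset Strict Implicit.
Unset Printing Implicit Defensive.

Import Order.TTheory GRing.Theory Num.Theory.
Import numFieldNormedType.Exports.

Local Open Scope classical_set_scope.
Local Open Scope ring_scope.

(* R^d is ['rV[R]_d]: its norm, balls and topology in the library are those of
   the sup norm.  [borel V] is [V] with its Borel sigma-algebra. *)
Notation borel V := (g_sigma_algebraType (@open V)).

Section HausdorffContent.
Context {R : realType} {V : normedModType R}.
Local Open Scope ereal_scope.

Definition diam (A : set V) : \bar R :=
  ereal_sup [set `|y - z|%:E | y in A & z in A].

(* [J] lists the indices in use, so that covers may be finite or empty: when
   [s = 0] every ball contributes [1] and an infinite family has infinite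
   sum. *)
Definition ball_cover (A : set V) (J : set nat) (x : nat -> V) (r : nat -> R) :=
  (forall n, J n -> (0 < r n)%R) /\
  A `<=` \bigcup_(n in J) closed_ball (x n) (r n).

Definition hausdorff_content (s : R) (A : set V) : \bar R :=
  ereal_inf [set t | exists (J : set nat) (x : nat -> V) (r : nat -> R),
    ball_cover A J x r /\
    t = \esum_(n in J) diam (closed_ball (x n) (r n)) `^ s].

Definition essential_content (mu : {measure set (borel V) -> \bar R})
    (s : R) (A : set V) : \bar R :=
  ereal_inf [set hausdorff_content s E | E in
    [set E : set V | [/\ E `<=` A, measurable (E : set (borel V)) &
                         mu E = mu A]]].

(* [D] is the mu-almost sure value of the local dimension; a measure has at
   most one such [D] if it is a probability.  Where [mu] vanishes on a small
   ball the quotient is [0] because [ln 0 = 0], but such points (outside the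
   support) form a null set when [V] is second countable. *)
Definition exact_dimensional (mu : {measure set (borel V) -> \bar R})
    (D : R) : Prop :=
  {ae mu, forall x : borel V,
    (ln (fine (mu (closed_ball (x : V) r))) / ln r)%R @[r --> (0 : R)^'+]
      --> D}.

End HausdorffContent.

Section SelfSimilar.
Context {R : realType} {d : nat}.

Definition eucl_norm (v : 'rV[R]_d) : R := Num.sqrt (\sum_i v ord0 i ^+ 2).

(* Similarity is meant in the Euclidean sense (homothety composed with an
   affine isometry).  Every similarity for the sup norm is one of these: its
   linear part is a multiple of a signed permutation matrix. *)
Definition contracting_similarity (f : 'rV[R]_d -> 'rV[R]_d) : Prop :=
  exists c : R, [/\ 0 < c, c < 1 &
    forall x y, eucl_norm (f x - f y) = c * eucl_norm (x - y)].

Definition self_similar_IFS (m : nat) (f : 'I_m -> 'rV[R]_d -> 'rV[R]_d) :=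
  (2 <= m)%N /\ forall i, contracting_similarity (f i).

Definition attractor (m : nat) (f : 'I_m -> 'rV[R]_d -> 'rV[R]_d)
    (K : set 'rV[R]_d) : Prop :=
  [/\ K !=set0, compact K & K = \bigcup_(i in [set: 'I_m]) (f i @` K)].

Definition probability_vector (m : nat) (p : 'I_m -> R) : Prop :=
  (forall i, 0 < p i < 1) /\ \sum_i p i = 1.

Definition self_similar_measure (m : nat) (f : 'I_m -> 'rV[R]_d -> 'rV[R]_d)
    (p : 'I_m -> R) (mu : probability (borel 'rV[R]_d) R) : Prop :=
  forall A : set (borel 'rV[R]_d), measurable A ->
    mu A = (\sum_i (p i)%:E * mu (f i @^-1` A))%E.

(* [mu] is a self-similar measure associated with a self-similar IFS [f] whose
   attractor is [K]. *)
Definition self_similar_system (m : nat) (f : 'I_m -> 'rV[R]_d -> 'rV[R]_d)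
    (K : set 'rV[R]_d) (mu : probability (borel 'rV[R]_d) R) : Prop :=
  [/\ self_similar_IFS f, attractor f K &
      exists p : 'I_m -> R, probability_vector p /\ self_similar_measure f p mu].

End SelfSimilar.

(* Main.v *)
(* Fix [s < dim mu].  A Frostman set [G], of positive measure, satisfies
   [mu (B(y, t)) <= C t^s] for all its points [y].  If [B] is a ball of radius
   [r] centered on [K] and [E] fills [B] up to a [mu]-null set, some similarity
   [g] of ratio at least [kappa r], composed of maps of the system, sends [K]
   into [B]; self-similarity makes [g^-1(E)] of full measure, so it meets [G] in
   positive measure, and a cover of [E] by balls pulls back to a cover of that
   part of [G].  No separation is needed since only the absolute continuity
   of the images of [mu] under the maps of the system is used.  The
   bound for an open set follows from the one for balls by a Vitali covering of
   the points that a given cover of [E] misses.  For [s > dim mu], Vitali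
   coverings of almost all of [K] by small balls with [mu B >= r^s'],
   [dim mu < s' < s], have arbitrarily small sums [r^s]. *)
Require Import Defs.
From HB Require Import structures.
From mathcomp Require Import all_boot all_order all_algebra.
From mathcomp Require Import all_classical all_reals all_analysis.
From mathcomp Require Import ring lra.
Import Order.TTheory GRing.Theory Num.Theory.
Import numFieldNormedType.Exports.
Local Open Scope classical_set_scope.
Local Open Scope ring_scope.
Local Open Scope ereal_scope.

Set Implicit Arguments.
Unset Strict Implicit.
Unset Printing Implicit Defensive.

(** * Sums over arbitrary index sets *)

(** [D] is the union over [n] of the sets where [a > 1/(n+1)]. Each of these is finite: an injection
    of the naturals into it would yield finite partial sums exceeding the total. *)
Lemma esum_lty_countable {R : realType} {T : choiceType} (D : set T)
    (a : T -> \bar R) :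
  (forall i, D i -> 0 < a i) -> \esum_(i in D) a i < +oo -> countable D.
Proof.
elim/choicePpointed: T => T in D a *; first by rewrite !emptyE.
move=> a0 aoo.
have -> : D = \bigcup_n [set i | D i /\ (n.+1%:R^-1)%:E < a i].
  apply/seteqP; split=> [i Di|i [n _ []]//].
  have := a0 _ Di; case ai : (a i) => [b| |]//.
    by move=> /ltr_add_invr[n]; rewrite add0r => nb; exists n => //=; rewrite ai.
  by exists 0%N => //=; rewrite ai; split => //; exact: ltry.
apply: bigcup_countable => // n _; apply: finite_set_countable.
apply: contrapT => /infiniteP/pcard_leP/injfunPex[/= q qD qinj].
have esumq : \esum_(i in q @` setT) a i <= \esum_(i in D) a i.
  rewrite esum_mkcond [leRHS]esum_mkcond; apply: le_esum => i _.
  case: ifPn => [|_]; last by case: ifPn => // /[!inE] /a0 /ltW.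
  by rewrite inE => -[k _ <-]; rewrite ifT// inE; case: (qD k I).
have [k kge] : exists k : nat, (fine (\esum_(i in D) a i) < k%:R * n.+1%:R^-1)%R.
  exists (Num.truncn (fine (\esum_(i in D) a i) * n.+1%:R)).+1.
  by rewrite ltr_pdivlMr// truncnS_gt.
have esumfin : \esum_(i in D) a i \is a fin_num.
  by rewrite ge0_fin_numE//; apply: esum_ge0 => i /a0/ltW.
suff : (k%:R * n.+1%:R^-1)%:E <= \esum_(i in D) a i.
  by rewrite -(fineK esumfin) lee_fin leNgt kge.
apply: le_trans esumq; rewrite esum_image//.
apply: esum_ge; exists `I_k; first by split => //; exact: finite_II.
rewrite -fsbig_ord /= (_ : (_ * _)%:E = \sum_(i < k) (n.+1%:R^-1)%:E).
  by apply: lee_sum => i _; case: (qD i I) => _ /ltW.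
by rewrite sumEFin sumr_const card_ord mulr_natl.
Qed.

Lemma esumZl_le {R : realType} {T : choiceType} (D : set T) (c : \bar R)
    (a : T -> \bar R) : 0 <= c -> (forall i, 0 <= a i) ->
  \esum_(i in D) (c * a i) <= c * \esum_(i in D) a i.
Proof.
move=> c0 a0; apply: ge_ereal_sup => _ [X [finX XD] <-].
rewrite -ge0_mule_fsumr//; apply: lee_wpmul2l => //.
by apply: ereal_sup_ubound; exists X.
Qed.

Lemma le_esum_subset {R : realType} {T : choiceType} (D E : set T)
    (a : T -> \bar R) : D `<=` E -> (forall i, E i -> 0 <= a i) ->
  \esum_(i in D) a i <= \esum_(i in E) a i.
Proof.
move=> DE a0; rewrite esum_mkcond [leRHS]esum_mkcond; apply: le_esum => i _.
have [/set_mem Di|_] := boolP (i \in D); last by case: ifPn => // /set_mem/a0.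
by rewrite ifT// inE; exact: DE.
Qed.

(** The double sum runs over pairs [(i, j)]; disjointness of the [F i] makes the second projection
    injective on these pairs. *)
Lemma esum_trivIset_le {R : realType} {T I : choiceType} (D : set I)
    (F : I -> set T) (E : set T) (a : T -> \bar R) :
  trivIset D F -> (forall i, D i -> F i `<=` E) -> (forall j, 0 <= a j) ->
  \esum_(i in D) \esum_(j in F i) a j <= \esum_(j in E) a j.
Proof.
move=> tF FE a0; rewrite esum_esum//.
rewrite -(@esum_image _ _ _ (D `*`` F) snd a); last first.
  move=> [i j] [i' j'] /set_mem/= [Di Fij] /set_mem/= [Di' Fij'] /= jj'.
  by rewrite jj' in Fij *; congr (_, _); apply: tF => //; exists j'.
by apply: le_esum_subset => // j [[i j'] /= [Di Fij] <-]; exact: (FE i).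
Qed.

(** * Hausdorff content *)

(** The points [x + r u] and [x - r u] realise the diameter. The unit vector excludes the zero
    space, where every diameter is [0]. *)
Lemma diam_closed_ball {R : realType} {V : normedModType R} (u x : V) (r : R) :
  (`|u| = 1)%R -> (0 < r)%R -> diam (closed_ball x r) = (2 * r)%:E.
Proof.
move=> u1 r0; rewrite /diam closed_ballE// /closed_ball_.
apply/eqP; rewrite eq_le; apply/andP; split.
  apply: ge_ereal_sup => _ [y /= xy [z /= xz <-]]; rewrite lee_fin.
  by have := ler_distD x y z; rewrite (distrC y x); lra.
apply: ereal_sup_ubound; exists (x + r *: u)%R.
  by rewrite /= opprD addNKr normrN normrZ u1 mulr1 gtr0_norm.
exists (x - r *: u)%R.
  by rewrite /= subKr normrZ u1 mulr1 gtr0_norm.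
congr EFin; rewrite opprB addrC addrA subrK -scalerDl normrZ u1 mulr1 gtr0_norm.
  by lra.
by rewrite addr_gt0.
Qed.

Lemma rV_unit_vector {R : realType} {d : nat} : (0 < d)%N ->
  exists u : 'rV[R]_d, (`|u| = 1)%R.
Proof.
case: d => // d _; exists (const_mx 1%R).
apply/eqP; rewrite eq_le; apply/andP; split.
  by rewrite /Num.norm/= mx_normrE; apply: bigmax_le => // i _; rewrite mxE normr1.
rewrite /Num.norm/= mx_normrE; apply: le_trans (@le_bigmax _ _ _ _ _ (ord0, ord0)).
by rewrite mxE normr1.
Qed.

Lemma hausdorff_content_le {R : realType} {V : normedModType R} (s : R)
    (A B : set V) : A `<=` B -> hausdorff_content s A <= hausdorff_content s B.
Proof.
move=> AB; apply: ereal_inf_le_tmp => _ [J [x [r [[r0 cov] ->]]]].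
by exists J, x, r; split => //; split => //; exact: subset_trans cov.
Qed.

Lemma hausdorff_content_ge0 {R : realType} {V : normedModType R} (s : R)
    (A : set V) : 0 <= hausdorff_content s A.
Proof.
apply: le_ereal_inf_tmp => _ [J [x [r [_ ->]]]].
by apply: esum_ge0 => n _; exact: poweR_ge0.
Qed.

(** Allows covers indexed by pairs or by points: an injection [f] into the naturals, with left
    inverse [g] on [D], turns them into covers of the form used in the definition. *)
Lemma hausdorff_content_le_esum {R : realType} {V : normedModType R} (s : R)
    (A : set V) (T : choiceType) (D : set T) (x : T -> V) (r : T -> R) :
  countable D -> (forall i, D i -> (0 < r i)%R) ->
  A `<=` \bigcup_(i in D) closed_ball (x i) (r i) ->
  hausdorff_content s A
    <= \esum_(i in D) diam (closed_ball (x i) (r i)) `^ s.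
Proof.
elim/choicePpointed: T => T in D x r *.
  rewrite !emptyE => _ _; rewrite bigcup_set0 subset0 => ->.
  apply: ereal_inf_lbound; exists set0, (fun=> 0%R), (fun=> 0%R).
  by rewrite !esum_set0; split => //; split.
move=> /countable_injP[f finj] r0 cov.
pose g n : T := xget point [set i | D i /\ f i = n].
have fg i : D i -> g (f i) = i.
  move=> Di; rewrite /g; case: xgetP => [j _ [Dj fji]|/(_ i)[]//].
  by apply: finj; rewrite ?inE.
apply: ereal_inf_lbound; exists (f @` D), (x \o g), (r \o g); split.
  split=> [_ [i Di <-]|y /cov[i Di yi]]; first by rewrite /= fg//; exact: r0.
  by exists (f i); [exists i|rewrite /= fg].
rewrite esum_image; last by move=> i j Di Dj; apply: finj.
by apply: eq_esum => i Di /=; rewrite fg.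
Qed.

Lemma hausdorff_contentU {R : realType} {V : normedModType R} (s : R)
    (A B : set V) :
  hausdorff_content s (A `|` B) <= hausdorff_content s A + hausdorff_content s B.
Proof.
have [->|Afin] := eqVneq (hausdorff_content s A) +oo.
  by rewrite addye ?leey// gt_eqF// (lt_le_trans _ (hausdorff_content_ge0 _ _)).
have [->|Bfin] := eqVneq (hausdorff_content s B) +oo.
  by rewrite addey ?leey// gt_eqF// (lt_le_trans _ (hausdorff_content_ge0 _ _)).
have fin (C : set V) : hausdorff_content s C != +oo ->
    hausdorff_content s C \is a fin_num.
  by move=> Cy; rewrite ge0_fin_numE ?ltey//; exact: hausdorff_content_ge0.
apply/lee_addgt0Pr => e e0.
have e20 : (0 < e / 2)%R by rewrite divr_gt0.
have [_ [J [x [r [[r0 cov] ->]]]] /ltW ltA] :=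
  lb_ereal_inf_adherent e20 (fin A Afin).
have [_ [J' [x' [r' [[r'0 cov'] ->]]]] /ltW ltB] :=
  lb_ereal_inf_adherent e20 (fin B Bfin).
rewrite [e]splitr EFinD addeACA; apply: le_trans (leeD ltA ltB).
(* The two near-optimal covers are merged over [bool * nat], the boolean telling which one a ball
   comes from. *)
pose D := [set i : bool * nat | if i.1 then J i.2 else J' i.2].
pose xx (i : bool * nat) := if i.1 then x i.2 else x' i.2.
pose rr (i : bool * nat) := if i.1 then r i.2 else r' i.2.
have /le_trans -> // : hausdorff_content s (A `|` B)
    <= \esum_(i in D) diam (closed_ball (xx i) (rr i)) `^ s.
  apply: hausdorff_content_le_esum; first exact: countableP.
  - by move=> [[] n]; [exact: r0|exact: r'0].
  - by move=> y [/cov|/cov'] [n Jn yn]; [exists (true, n)|exists (false, n)].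
rewrite (esumID [set i : bool * nat | i.1] D); last first.
  by move=> i _; exact: poweR_ge0.
have -> : D `&` [set i : bool * nat | i.1] = pair true @` J.
  apply/seteqP; split=> [[[] n] [Dn] //= _|[_ _] [n Jn [<- <-]]//].
  by exists n.
have -> : D `&` ~` [set i : bool * nat | i.1] = pair false @` J'.
  apply/seteqP; split=> [[[] n] [Dn] //= _|[_ _] [n Jn [<- <-]]//].
  by exists n.
by rewrite !esum_image// => m n _ _ [].
Qed.

(* Zorn on the subfamilies [D] such that every ball meeting one of [D] meets
   one of [D] of at least half its radius. *)
Lemma vitali_disjoint_balls {R : realType} {V : normedModType R} (A : set V)
    (r : V -> R) (M : R) :
  (forall x, A x -> 0 < r x <= M)%R ->
  exists D, [/\ D `<=` A, trivIset D (fun x => ball x (r x)) &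
    A `<=` \bigcup_(x in D) closed_ball x (3 * r x)].
Proof.
move=> rM; pose B x := ball x (r x).
pose meets x y := (B x `&` B y !=set0).
pose P (D : set V) := [/\ D `<=` A, trivIset D B & forall x, A x ->
  (exists2 y, D y & meets x y) ->
  exists y, [/\ D y, meets x y & (r x <= 2 * r y)%R]].
have [F FP Ftot|D [[DA tD halfD] maxD]] := @Zorn_bigcup V P.
  split.
  - by apply: bigcup_sub => X /FP[].
  - move=> x y [X FX Xx] [Y FY Yy].
    have [XY|YX] := Ftot _ _ FX FY.
      by have [_ + _] := FP _ FY; apply=> //; exact: XY.
    by have [_ + _] := FP _ FX; apply=> //; exact: YX.
  - move=> x Ax [y [X FX Xy] xy]; have [_ _ /(_ _ Ax)[|z [Xz xz rxz]]] := FP _ FX.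
      by exists y.
    by exists z; split => //; exists X.
have BB x : A x -> meets x x.
  by move=> Ax; exists x; split; apply: ballxx; have /andP[] := rM _ Ax.
(* If some ball misses [D], one of radius more than half the supremum over all such balls can be
   added to [D], against maximality. *)
have hit x : A x -> exists2 y, D y & meets x y.
  move=> Ax; apply: contrapT => nx.
  pose S := [set z | A z /\ ~ exists2 y, D y & meets z y].
  have Sx : S x by [].
  have supS : has_sup (r @` S).
    split; first by exists (r x), x.
    by exists M => _ [z [Az _] <-]; have /andP[] := rM _ Az.
  have rx0 : (0 < r x)%R by have /andP[] := rM _ Ax.
  have rS z : S z -> (r z <= sup (r @` S))%R.
    by move=> Sz; apply: ub_le_sup; [case: supS|exists z].
  have sup0 : (0 < sup (r @` S) / 2)%R by have := rS _ Sx; lra.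
  have [_ [x0 [Ax0 nx0] <-] x0sup] := sup_adherent sup0 supS.
  have Dx0 : ~ D x0 by move=> Dx0; apply: nx0; exists x0 => //; exact: BB.
  apply: (maxD (D `|` [set x0])).
    by split=> [y Dy|/(_ x0)]; [left|move=> /(_ (or_intror erefl))].
  split.
  - by move=> y [/DA//|->].
  - move=> y z [Dy|->] [Dz|->] //; first exact: tD.
      move=> yz; exfalso; apply: nx0; exists y => //.
      by rewrite /meets setIC.
    by move=> zx; exfalso; apply: nx0; exists z.
  - move=> y Ay [z Dz yz].
    have [[w Dw yw]|ny] := pselect (exists2 w, D w & meets y w).
      have [v [Dv yv rv]] := halfD _ Ay (ex_intro2 _ _ _ Dw yw).
      by exists v; split => //; left.
    case: Dz => [Dz|zx0]; first by exfalso; apply: ny; exists z.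
    exists x0; split; [by right|by rewrite -zx0|].
    by have := rS y (conj Ay ny); lra.
(* Only the centers are to be covered: meeting balls with [r x <= 2 r y] have centers at distance
   less than [r x + r y <= 3 r y]. *)
exists D; split => // x Ax.
have [y [Dy [z [xz yz]] rxy]] := halfD _ Ax (hit _ Ax).
have ry0 : (0 < r y)%R by have /andP[] := rM _ (DA _ Dy).
exists y => //; rewrite closed_ballE /closed_ball_ /=; last by rewrite mulr_gt0.
move: xz yz; rewrite /B -!ball_normE /ball_ /= => xz yz.
by have := ler_distD z y x; rewrite (distrC z x); lra.
Qed.

(** Tripling a disjoint Vitali subfamily covers [A] with balls of diameter [6 r x], whence the
    factor [6 ^ s]. When [C] is finite, the subfamily is countable because its sum is. *)
Lemma hausdorff_content_packing {R : realType} {V : normedModType R} (u : V)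
    (s : R) (A : set V) (r : V -> R) (M : R) (C : \bar R) :
  (`|u| = 1)%R -> (0 <= s)%R -> (forall x, A x -> 0 < r x <= M)%R ->
  (forall D, D `<=` A -> trivIset D (fun x => ball x (r x)) ->
    \esum_(x in D) (r x `^ s)%:E <= C) ->
  hausdorff_content s A <= (6 `^ s)%:E * C.
Proof.
move=> u1 s0 rM pack.
have [D [DA tD cov]] := vitali_disjoint_balls rM.
have r0 x : A x -> (0 < r x)%R by move=> /rM/andP[].
have {pack} packD := pack D DA tD.
have [Coo|Coo] := eqVneq C +oo.
  by rewrite Coo gt0_muley ?leey// lte_fin powR_gt0.
have cD : countable D.
  apply: (@esum_lty_countable _ _ _ (fun x => (r x `^ s)%:E)).
    by move=> x /DA Ax; rewrite lte_fin powR_gt0// r0.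
  by rewrite (le_lt_trans packD)// ltey.
have := @hausdorff_content_le_esum _ _ s A _ D id (fun x => 3 * r x)%R cD.
move=> /(_ _ cov) /le_trans; apply.
  by move=> x /DA Ax; rewrite mulr_gt0// r0.
apply: le_trans (lee_wpmul2l _ packD); last by rewrite lee_fin powR_ge0.
have -> : \esum_(x in D) diam (closed_ball x (3 * r x)) `^ s =
    \esum_(x in D) ((6 `^ s)%:E * (r x `^ s)%:E).
  apply: eq_esum => x /DA Ax.
  rewrite (diam_closed_ball _ u1); last by rewrite mulr_gt0// r0.
  rewrite poweR_EFin -EFinM -powRM ?ltW ?r0// mulrA.
  by congr ((_ * _) `^ _)%:E; lra.
by apply: esumZl_le => [|x]; rewrite lee_fin powR_ge0.
Qed.

(** * Borel measures *)

Lemma borel_open {R : realType} {V : normedModType R} (A : set V) :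
  open A -> measurable (A : set (borel V)).
Proof. by move=> oA; exact: sub_sigma_algebra. Qed.

Lemma borel_closed {R : realType} {V : normedModType R} (A : set V) :
  closed A -> measurable (A : set (borel V)).
Proof.
move=> cA; rewrite -(setCK A); apply: (@measurableC _ (borel V)).
by apply: borel_open; exact: closed_openC.
Qed.

Lemma borel_continuous {R : realType} {V : normedModType R} (f : V -> V) :
  continuous f -> forall A : set (borel V), measurable A ->
  measurable (f @^-1` A : set (borel V)).
Proof.
move=> cf A mA; rewrite -[X in measurable X]setTI.
apply: (@measurability _ _ (borel V) (borel V) setT f open) => //.
move=> _ [B oB <-]; rewrite setTI; apply: borel_open.
by apply: open_comp => // x _; exact: cf.
Qed.

Lemma measure_setD_eq0 d (T : measurableType d) {R : realType}
    (mu : probability T R) (A E : set T) : measurable A -> measurable E ->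
  E `<=` A -> mu E = mu A -> mu (A `\` E) = 0.
Proof.
move=> mA mE EA muE; rewrite measureD//; last first.
  by rewrite (le_lt_trans (probability_le1 _ _))// ltry.
rewrite (setIidr EA) /= muE subee// ge0_fin_numE//.
by rewrite (le_lt_trans (probability_le1 _ _))// ltry.
Qed.

(** If [E] fills [B] up to a null set, then the smaller set [E] intersected with [A] fills [A] up to
    a null set. *)
Lemma essential_content_le {R : realType} {V : normedModType R}
    (mu : probability (borel V) R) (s : R) (A B : set V) :
  measurable (A : set (borel V)) -> measurable (B : set (borel V)) ->
  A `<=` B -> essential_content mu s A <= essential_content mu s B.
Proof.
move=> mA mB AB; apply: le_ereal_inf_tmp => _ [E [EB mE muE] <-].
apply: (@le_trans _ _ (hausdorff_content s (E `&` A))); last first.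
  by apply: hausdorff_content_le; exact: subIsetl.
apply: ereal_inf_lbound; exists (E `&` A) => //.
have mEA : measurable (E `&` A : set (borel V)) by exact: measurableI.
split => //.
rewrite /= (measureDI mu mA mE) setIC [X in X + _](_ : _ = 0) ?add0e//.
apply: (subset_measure0 _ _ _ (measure_setD_eq0 mB mE EB muE)).
- exact: measurableD.
- exact: measurableD.
- exact: setSD.
Qed.

Lemma subset_ball_shift {R : realType} {V : normedModType R} (x y : V) (r e : R) :
  ball x e y -> ball x (r - e) `<=` ball y r.
Proof.
rewrite -!ball_normE /ball_ => /= xy z /= xz.
by have := ler_distD x y z; rewrite (distrC y x); lra.
Qed.

(** The measure of an open ball is lower semicontinuous in the center: if it exceeds [t] at [x], so
    does that of a slightly smaller ball, which lies in [ball y r] for [y] near [x]. *)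
Lemma closed_measure_ball_le {R : realType} {V : normedModType R}
    (mu : probability (borel V) R) (r : R) (t : \bar R) :
  closed [set x : V | mu (ball x r) <= t].
Proof.
move=> x cx; rewrite /= leNgt; apply/negP => tx.
have mball (y : V) e : measurable (ball y e : set (borel V)).
  by apply: borel_open; exact: ball_open.
pose F n : set (borel V) := ball x (r - n.+1%:R^-1).
have FE : \bigcup_n F n = ball x r.
  apply/seteqP; split=> [y [n _]|y].
    by apply: le_ball; rewrite gerBl invr_ge0.
  rewrite -ball_normE /ball_ /= => /ltr_add_invr[n rn]; exists n => //.
  by rewrite /F -ball_normE /ball_ /= ltrBrDr.
have [n tn] : exists n, t < mu (F n).
  apply: contrapT => /forallNP nt; move: tx; rewrite -FE; apply/negP.
  rewrite -leNgt.
  have cvgF : mu \o F @ \oo --> mu (\bigcup_n F n).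
    apply: nondecreasing_cvg_mu => [n||n m nm]; first exact: mball.
      by apply: bigcup_measurable => n _; exact: mball.
    apply/subsetPset; apply: le_ball; rewrite lerD2l lerN2.
    by rewrite lef_pV2 ?posrE// ler_nat.
  apply: (cvge_le _ cvgF).
  by apply: nearW => n; rewrite leNgt; apply/negP; exact: nt.
have n0 : (0 < n.+1%:R^-1 :> R)%R by rewrite invr_gt0.
have [y [/= + xy]] := cx _ (nbhsx_ballx x _ n0).
rewrite leNgt => /negP; apply; apply: (lt_le_trans tn).
by apply: le_measure; rewrite ?inE; [exact: mball..|exact: subset_ball_shift].
Qed.

(** * Frostman sets and disjoint families *)

Lemma ler_powR_base {R : realType} (s a b : R) :
  (0 <= s)%R -> (0 <= a)%R -> (a <= b)%R -> (a `^ s <= b `^ s)%R.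
Proof.
move=> s0 a0 ab; apply: ge0_ler_powR; rewrite ?nnegrE//.
exact: le_trans ab.
Qed.

Lemma near_right0 {R : realType} (P : set R) : (\forall r \near 0^'+, P r) ->
  exists2 e : R, (0 < e)%R & forall r, (0 < r < e)%R -> P r.
Proof.
move=> [e /= e0 he]; exists e => // r /andP[r0 re].
by apply: he => //=; rewrite sub0r normrN gtr0_norm.
Qed.

(** At almost every point the local dimension exceeds [s], so [mu (ball x r) <= r ^ s] for all small
    [r]. The sets [G n] on which this holds below [1/(n+1)] thus cover almost everything, and one of
    them has positive measure. *)
Lemma exact_dimensional_frostman {R : realType} {V : normedModType R}
    (mu : probability (borel V) R) (D s : R) :
  exact_dimensional mu D -> (0 <= s)%R -> (s < D)%R ->
  exists (G : set V) (C : R), [/\ closed G, 0 < mu G, (0 < C)%R &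
    forall y rho, G y -> (0 < rho)%R ->
      mu (closed_ball y rho) <= (C * rho `^ s)%:E].
Proof.
move=> hD s0 sD.
(* Open balls make [G n] closed. Closed balls are recovered at the end by doubling the radius, hence
   the [2] in the constant. *)
pose G n := \bigcap_(r in [set r : R | 0 < r < n.+1%:R^-1]%R)
  [set x : V | mu (ball x r) <= (r `^ s)%:E].
have cG n : closed (G n).
  by apply: closed_bigI => r _; exact: closed_measure_ball_le.
have [n Gn0] : exists n, 0 < mu (G n).
  apply: contrapT => /forallNP G0.
  have negG : mu.-negligible (\bigcup_n (G n : set (borel V))).
    apply: negligible_bigcup => n; apply/negligibleP; first exact: borel_closed.
    apply/eqP; rewrite eq_le measure_ge0 andbT leNgt; apply/negP; exact: G0.
  have := negligibleU hD negG.
  rewrite (_ : _ `|` _ = setT); last first.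
    apply/seteqP; split => // x _.
    have [xD|xD] := pselect ((ln (fine (mu (closed_ball (x : V) r))) / ln r)%R
      @[r --> (0 : R)^'+] --> D); last by left.
    right.
    have [e e0 he] := near_right0 (cvgr_gt _ xD _ sD).
    have [n ne] : exists n, (n.+1%:R^-1 < Num.min e 1)%R.
      have : (0 < Num.min e 1)%R by rewrite lt_min e0 ltr01.
      by move=> /ltr_add_invr[n]; rewrite add0r; exists n.
    exists n => // r /= /andP[r0 rn].
    have [re r1] : (r < e /\ r < 1)%R.
      by apply/andP; rewrite -lt_min; exact: lt_trans ne.
    have lnr : (ln r < 0)%R by rewrite ln_lt0// r0.
    have := he r; rewrite r0 re => /(_ isT).
    rewrite ltr_ndivlMr//.
    set m := fine _; move=> lnm.
    apply: (@le_trans _ _ (mu (closed_ball (x : V) r))).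
      apply: le_measure; rewrite ?inE.
      - by apply: borel_open; exact: ball_open.
      - by apply: borel_closed; exact: closed_ball_closed.
      - exact: subset_closed_ball.
    have mfin : mu (closed_ball (x : V) r) \is a fin_num.
      apply: fin_num_measure; apply: borel_closed; exact: closed_ball_closed.
    rewrite -(fineK mfin) -/m lee_fin.
    have : (0 <= m)%R by apply: fine_ge0.
    rewrite le_eqVlt => /predU1P[<-|m0]; first exact: powR_ge0.
    have rs0 : (0 < r `^ s)%R by exact: powR_gt0.
    by apply: ltW; rewrite -ltr_ln ?posrE// ln_powR.
  move=> negT; have := proj1 (negligibleP mu measurableT) negT.
  by rewrite /= probability_setT => /eqP; rewrite onee_eq0.
exists (G n), ((2 * n.+1%:R) `^ s)%R.
split; [exact: cG|exact: Gn0|by rewrite powR_gt0|].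
move=> y rho Gy rho0.
have r20 : (0 < 2 * rho)%R by rewrite mulr_gt0.
(* For large radii the constant makes the right-hand side at least [1]. *)
have [small|big] := ltP (2 * rho)%R (n.+1%:R^-1)%R; last first.
  apply: (le_trans (probability_le1 _ _)).
    by apply: borel_closed; exact: closed_ball_closed.
  rewrite lee_fin -powRM//; last exact: ltW.
  have {1}<- : (1 `^ s = 1 :> R)%R by rewrite powR1.
  apply: ler_powR_base => //.
  by move: big; rewrite -[leLHS]mul1r ler_pdivrMr// mulrAC.
apply: (@le_trans _ _ (mu (ball y (2 * rho)))).
  apply: le_measure; rewrite ?inE.
  - by apply: borel_closed; exact: closed_ball_closed.
  - by apply: borel_open; exact: ball_open.
  - by apply: closed_ball_subset => //; lra.
apply: (le_trans (Gy _ _)) => /=; first by rewrite r20.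
rewrite lee_fin -powRM//; last exact: ltW.
apply: ler_powR_base => //; first exact: ltW.
by rewrite mulrAC ler_peMr ?(ltW r20)// ler1n.
Qed.

Lemma esum_trivIset_probability d (T : measurableType d) {R : realType}
    (mu : probability T R) {I : choiceType} (D : set I) (F : I -> set T) :
  trivIset D F -> (forall i, D i -> measurable (F i)) ->
  \esum_(i in D) mu (F i) <= 1.
Proof.
move=> tF mF; apply: ge_ereal_sup => _ [X [finX XD] <-].
rewrite -measure_fin_bigcup//.
- apply: probability_le1; apply: fin_bigcup_measurable => // i /XD; exact: mF.
- exact: sub_trivIset tF.
- by move=> i /XD; exact: mF.
Qed.

(** * Self-similar systems *)

Lemma eucl_norm_ge0 {R : realType} {d : nat} (v : 'rV[R]_d) :
  (0 <= eucl_norm v)%R.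
Proof. exact: sqrtr_ge0. Qed.

Lemma mx_norm_le_eucl_norm {R : realType} {d : nat} (v : 'rV[R]_d) :
  (`|v| <= eucl_norm v)%R.
Proof.
rewrite /Num.norm/= mx_normrE; apply: bigmax_le => [|[i j] _ /=].
  exact: eucl_norm_ge0.
rewrite -sqrtr_sqr ler_wsqrtr// (bigD1 j)//= (ord1 i) lerDl.
by apply: sumr_ge0 => k _; exact: sqr_ge0.
Qed.

Lemma eucl_norm_le_mx_norm {R : realType} {d : nat} (v : 'rV[R]_d) :
  (eucl_norm v <= Num.sqrt d%:R * `|v|)%R.
Proof.
have -> : (Num.sqrt d%:R * `|v| = Num.sqrt (d%:R * `|v| ^+ 2))%R.
  by rewrite sqrtrM// sqrtr_sqr normr_id.
rewrite ler_wsqrtr// mulr_natl -[X in (_ *+ X)%R]card_ord -sumr_const.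
apply: ler_sum => i _; rewrite -real_normK ?num_real// lerXn2r ?nnegrE//.
rewrite [leRHS]/Num.norm/= mx_normrE.
exact: le_trans (@le_bigmax _ _ _ _ (fun j => `|v j.1 j.2|)%R (ord0, i)).
Qed.

Lemma eucl_norm_continuous {R : realType} {d : nat} :
  continuous (@eucl_norm R d).
Proof.
have csum : continuous (fun v : 'rV[R]_d => \sum_i v ord0 i ^+ 2)%R.
  apply: continuous_big => [|i _ v]; first exact: add_continuous.
  apply: (@continuous_comp _ _ _ (fun v : 'rV[R]_d => v ord0 i) (fun t => t ^+ 2)%R).
    exact: coord_continuous.
  exact: exprn_continuous.
move=> v; apply: continuous_comp; first exact: csum.
exact: sqrt_continuous.
Qed.

Lemma open_eucl_ball {R : realType} {d : nat} (y : 'rV[R]_d) (e : R) :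
  open [set x : 'rV[R]_d | (eucl_norm (x - y) < e)%R].
Proof.
have c1 : continuous (fun x : 'rV[R]_d => x - y)%R.
  move=> x; apply: (@cvgB R _ _ (nbhs x) _ id (fun=> y) x y).
    exact: cvg_id.
  exact: cvg_cst.
have c2 : continuous (fun x : 'rV[R]_d => eucl_norm (x - y)).
  by move=> x; apply: (continuous_comp (c1 x)); exact: eucl_norm_continuous.
exact: (open_comp (f := fun x : 'rV[R]_d => eucl_norm (x - y))
  (D := [set t | t < e]%R)).
Qed.

Definition similarity {R : realType} {d : nat} (c : R)
    (f : 'rV[R]_d -> 'rV[R]_d) :=
  forall x y, eucl_norm (f x - f y) = (c * eucl_norm (x - y))%R.

Lemma similarity_lipschitz {R : realType} {d : nat} (c : R)
    (f : 'rV[R]_d -> 'rV[R]_d) : (0 <= c)%R -> similarity c f ->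
  forall x y, (`|f x - f y| <= c * Num.sqrt d%:R * `|x - y|)%R.
Proof.
move=> c0 fc x y; apply: le_trans (mx_norm_le_eucl_norm _) _.
by rewrite fc -mulrA ler_wpM2l// eucl_norm_le_mx_norm.
Qed.

Lemma similarity_continuous {R : realType} {d : nat} (c : R)
    (f : 'rV[R]_d -> 'rV[R]_d) : (0 <= c)%R -> similarity c f -> continuous f.
Proof.
move=> c0 fc x A /nbhs_ballP[e /= e0 eA].
pose k := (c * Num.sqrt d%:R + 1)%R.
have k0 : (0 < k)%R by rewrite ltr_wpDl// mulr_ge0// sqrtr_ge0.
apply/nbhs_ballP; exists (e / k)%R => /=; first exact: divr_gt0.
move=> y; rewrite -ball_normE /ball_ /= ltr_pdivlMr// => xy; apply: eA.
rewrite -ball_normE /ball_ /=; apply: le_lt_trans xy.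
apply: le_trans (similarity_lipschitz c0 fc x y) _.
by rewrite mulrC ler_wpM2l// lerDl.
Qed.

(** The product replaces a minimum over the indices. Applied to the ratios and to their complements
    to [1], it keeps the ratios uniformly away from [0] and from [1]. *)
Lemma prod_le_factor {R : realType} (m : nat) (c : 'I_m -> R) :
  (forall i, 0 < c i < 1)%R ->
  (0 < \prod_i c i)%R /\ forall i, (\prod_i c i <= c i)%R.
Proof.
move=> c01; split; first by apply: prodr_gt0 => i _; case/andP: (c01 i).
move=> i; rewrite (bigD1 i)//= ler_piMr//; first by case/andP: (c01 i) => /ltW.
by apply: prodr_ile1 => j _; case/andP: (c01 j) => /ltW-> /ltW.
Qed.

Lemma self_similar_IFS_ratios {R : realType} {d m : nat}
    (f : 'I_m -> 'rV[R]_d -> 'rV[R]_d) : self_similar_IFS f ->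
  exists (c : 'I_m -> R) (a b : R), [/\ (0 < a < 1)%R, (0 < b)%R &
    forall i, similarity (c i) (f i) /\ (b <= c i <= a)%R].
Proof.
move=> [m2 /choice[c fc]].
have c01 i : (0 < c i < 1)%R by case: (fc i) => -> ->.
have c01' i : (0 < 1 - c i < 1)%R.
  by rewrite subr_gt0 gtrBl andbC; exact: c01.
have [b0 bc] := prod_le_factor c01; have [a0 ac] := prod_le_factor c01'.
have ca i : (c i <= 1 - \prod_i (1 - c i))%R by have := ac i; lra.
exists c, (1 - \prod_i (1 - c i))%R, (\prod_i c i)%R; split => //.
  apply/andP; split; last by lra.
  have i0 : 'I_m by exact: Ordinal m2.
  by apply: lt_le_trans (ca i0); case/andP: (c01 i0).
by move=> i; split; [case: (fc i)|rewrite bc ca].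
Qed.

Lemma exprn_lt {R : realType} (a x : R) : (0 <= a < 1)%R -> (0 < x)%R ->
  exists n, (a ^+ n < x)%R.
Proof.
move=> /andP[a0 a1] x0.
have /cvgr0_norm_lt /(_ _ x0) [n _ /(_ n)] : (fun n => a ^+ n)%R @ \oo --> (0%R : R).
  by apply: cvg_expr; rewrite ger0_norm.
by rewrite /= leqnn => /(_ isT) xn; exists n; rewrite (le_lt_trans _ xn)// ler_norm.
Qed.

Section SelfSimilarSystem.
Context {R : realType} {d m : nat}.
Context (f : 'I_m -> 'rV[R]_d -> 'rV[R]_d) (K : set 'rV[R]_d).
Context (mu : probability (borel 'rV[R]_d) R).
Context (sys : self_similar_system f K mu).

Let V := 'rV[R]_d.

Lemma attractor_closed : closed K.
Proof.
case: sys => _ [_ cK _] _; exact: compact_closed.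
Qed.

Lemma self_similar_system_preimage_null (i : 'I_m) (A : set (borel V)) :
  measurable A -> mu A = 0 -> mu (f i @^-1` A) = 0.
Proof.
move=> mA muA; case: sys => _ _ [p [[p01 _] muE]].
move: muA; rewrite muE// => /eqP; rewrite seq_psume_eq0; last first.
  by move=> j _; rewrite mule_ge0// lee_fin; case/andP: (p01 j) => /ltW.
move=> /allP/(_ i); rewrite mem_index_enum => /(_ isT) /=.
by rewrite mule_eq0 eqe gt_eqF ?(andP (p01 i)).1//= => /eqP.
Qed.

(** Each map sends the [e / a]-neighbourhood of [K] into the [e]-neighbourhood, so by
    self-similarity the latter has at least the measure of the former. Iteration exhausts the space:
    every neighbourhood of [K] has measure [1], and so has the closed set [K]. *)
Lemma self_similar_measure_attractor : mu K = 1.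
Proof.
have cK := attractor_closed.
have [IFSf [[z Kz] _ KE] [p [[p01 p1] muE]]] := sys.
have [c [a [b [/andP[a0 a1] b0 fc]]]] := self_similar_IFS_ratios IFSf.
pose U (e : R) := [set x : V | exists2 y, K y & (eucl_norm (x - y) < e)%R].
have oU e : open (U e).
  have -> : U e = \bigcup_(y in K) [set x | (eucl_norm (x - y) < e)%R].
    by apply/seteqP; split=> x [y Ky xy]; exists y.
  apply: bigcup_open => y Ky.
  exact: open_eucl_ball.
have mU e : measurable (U e : set (borel V)) by exact: borel_open.
have Ustep e : mu (U (e / a)%R) <= mu (U e).
  rewrite [leRHS]muE//.
  have -> : mu (U (e / a)%R) = \sum_i (p i)%:E * mu (U (e / a)%R).
    rewrite -ge0_sume_distrl; last first.
      by move=> i _; rewrite lee_fin; case/andP: (p01 i) => /ltW.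
    by rewrite sumEFin p1 mul1e.
  apply: lee_sum => i _; apply: lee_wpmul2l.
    by rewrite lee_fin; case/andP: (p01 i) => /ltW.
  have [fi /andP[bc ca]] := fc i.
  apply: le_measure; rewrite ?inE//.
    apply: borel_continuous => //; apply: similarity_continuous fi.
    by apply: ltW; exact: lt_le_trans bc.
  move=> x [y Ky xy]; exists (f i y); first by rewrite KE; exists i => //; exists y.
  rewrite fi; move: xy; rewrite ltr_pdivlMr// mulrC; apply: le_lt_trans.
  by rewrite ler_wpM2r// eucl_norm_ge0.
have Uiter n e : mu (U (e / a ^+ n)%R) <= mu (U e).
  elim: n => [|n IHn]; first by rewrite expr0 divr1.
  apply: le_trans IHn; apply: le_trans (Ustep _).
  by rewrite exprSr invfM mulrA.
have U1 e : (0 < e)%R -> mu (U e) = 1.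
  move=> e0; apply/eqP; rewrite eq_le probability_le1//=.
  pose F n : set (borel V) := U (e / a ^+ n)%R.
  have FT : \bigcup_n F n = setT.
    apply/seteqP; split => // x _.
    have xz0 : (0 < eucl_norm (x - z) + 1)%R by rewrite ltr_wpDl// eucl_norm_ge0.
    have [||n ne] := @exprn_lt R a (e / (eucl_norm (x - z) + 1))%R.
    - by rewrite ltW.
    - exact: divr_gt0.
    exists n => //; exists z => //.
    rewrite ltr_pdivlMr ?exprn_gt0//.
    move: ne; rewrite ltr_pdivlMr//; apply: le_lt_trans.
    by rewrite mulrC ler_wpM2l ?exprn_ge0 ?(ltW a0)// lerDl.
  have cvgF : mu \o F @ \oo --> mu (\bigcup_n F n).
    apply: nondecreasing_cvg_mu => [n||]; first exact: mU.
      by rewrite FT; exact: measurableT.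
    apply/nondecreasing_seqP => n; apply/subsetPset => x [y Ky xy].
    exists y => //; apply: lt_le_trans xy _.
    rewrite exprSr invfM mulrA ler_peMr ?invf_ge1 ?(ltW a1)//.
    by rewrite divr_ge0// ?exprn_ge0// ltW.
  rewrite -(@probability_setT _ _ _ mu) -[X in mu X]FT.
  apply: (cvge_le _ cvgF); apply: nearW => n; exact: Uiter.
have negK : mu.-negligible (~` K : set (borel V)).
  apply: (@negligibleS _ _ _ _ (\bigcup_n ~` (U n.+1%:R^-1%R : set (borel V)))).
    move=> x nKx.
    have : nbhs x (~` K) by apply: open_nbhs_nbhs; split => //; exact: closed_openC.
    move=> /nbhs_ballP[e /= e0 eK].
    have [n ne] : exists n, (n.+1%:R^-1 < e)%R.
      by move/ltr_add_invr: e0 => [n]; rewrite add0r; exists n.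
    exists n => // -[y Ky xy]; apply: (eK y) => //.
    rewrite -ball_normE /ball_ /=.
    by apply: le_lt_trans (mx_norm_le_eucl_norm _) _; exact: lt_trans ne.
  apply: negligible_bigcup => n; apply/negligibleP; first exact: measurableC.
  by apply: (etrans (probability_setC mu (mU _))); rewrite U1// subee.
have mK := borel_closed cK.
have muC := proj1 (negligibleP mu (measurableC mK)) negK.
have := probability_setC mu (measurableC mK); rewrite setCK => ->.
by rewrite [X in 1 - X]muC sube0.
Qed.

(** Write [x = f i x'] with [x'] in [K], find a copy around [x'] at radius [r / c i], and compose it
    with [f i]. The descent stops with the identity once the radius exceeds a bound [M] on the
    diameter of [K]. Null sets pull back to null sets along each map. *)
Lemma similar_copy_in_ball : exists2 kappa : R, (0 < kappa)%R &
  forall x r, K x -> (0 < r <= 1)%R ->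
  exists (rho : R) (g : V -> V), [/\ (kappa * r <= rho)%R, similarity rho g,
    g @` K `<=` ball x r &
    forall A : set (borel V), measurable A -> mu A = 0 -> mu (g @^-1` A) = 0].
Proof.
have [IFSf [_ compK KE] _] := sys.
have [c [a [b [/andP[a0 a1] b0 fc]]]] := self_similar_IFS_ratios IFSf.
have [M M0 KM] : exists2 M, (0 < M)%R &
    forall x y, K x -> K y -> (eucl_norm (x - y) < M)%R.
  have [M [_ KM]] := compact_bounded compK.
  have KM1 z : K z -> (`|z| <= `|M| + 1)%R.
    by apply: KM; rewrite (le_lt_trans (ler_norm M))// ltrDl.
  have M0 : (0 <= Num.sqrt d%:R * ((`|M| + 1) + (`|M| + 1)))%R.
    by rewrite mulr_ge0 ?sqrtr_ge0// !addr_ge0.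
  exists (Num.sqrt d%:R * ((`|M| + 1) + (`|M| + 1)) + 1)%R.
    by rewrite ltr_wpDl.
  move=> x y Kx Ky; apply: (le_lt_trans (eucl_norm_le_mx_norm _)).
  rewrite ltr_pwDr// ler_wpM2l ?sqrtr_ge0//.
  by rewrite (le_trans (ler_normB _ _))// lerD ?KM1.
(* The [1] bounds the given radius; [M / b] bounds a radius at most [M] after division by a
   ratio. *)
pose R0 := (1 + M / b)%R.
have Mb0 : (0 < M / b)%R by rewrite divr_gt0.
have R00 : (0 < R0)%R by rewrite addr_gt0.
exists (R0^-1)%R; first by rewrite invr_gt0.
(* Radii up to [R0] are needed in the induction, which divides the radius by
   the ratio of the first map. *)
suff copy n : forall x r, K x -> (0 < r <= R0)%R -> (a ^+ n * M < r)%R ->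
    exists (rho : R) (g : V -> V), [/\ (R0^-1 * r <= rho)%R, similarity rho g,
    forall y, K y -> (eucl_norm (x - g y) < r)%R &
    forall A : set (borel V), measurable A -> mu A = 0 -> mu (g @^-1` A) = 0].
  move=> x r Kx /andP[r0 r1].
  have [||n nr] := @exprn_lt R a (r / M)%R; first by rewrite ltW.
    exact: divr_gt0.
  have [//|||rho [g [rhor grho gK gnull]]] := copy n x r.
  - by rewrite r0 (le_trans r1)// lerDl ltW.
  - by rewrite -ltr_pdivlMr.
  exists rho, g; split => // _ [y Ky <-].
  rewrite -ball_normE /ball_ /=.
  by apply: le_lt_trans (mx_norm_le_eucl_norm _) _; exact: gK.
have id_copy x r : K x -> (0 < r <= R0)%R -> (M < r)%R ->
    exists (rho : R) (g : V -> V), [/\ (R0^-1 * r <= rho)%R, similarity rho g,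
    forall y, K y -> (eucl_norm (x - g y) < r)%R &
    forall A : set (borel V), measurable A -> mu A = 0 -> mu (g @^-1` A) = 0].
  move=> Kx /andP[r0 rR] Mr; exists 1%R, id; split => //.
  - by rewrite mulrC ler_pdivrMr// mul1r.
  - by move=> y z; rewrite mul1r.
  - by move=> y Ky; rewrite (lt_trans (KM _ _ Kx Ky)).
(* [n] bounds the number of maps still to compose: ratios are at most [a], so each division of [r]
   by a ratio saves a factor [a] in [a ^+ n * M < r]. *)
elim: n => [|n IHn] x r Kx rR Mr.
  by apply: id_copy => //; rewrite expr0 mul1r in Mr.
have [rM|Mr'] := leP r M; last exact: id_copy.
have [r0 rR0] := andP rR.
have [i _ [x' Kx' fx']] : (\bigcup_(i in [set: 'I_m]) (f i @` K)) x by rewrite -KE.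
have [fi /andP[bc ca]] := fc i.
have c0 : (0 < c i)%R by exact: lt_le_trans bc.
have [//|||rho [g [rhor grho gK gnull]]] := IHn x' (r / c i)%R.
- rewrite divr_gt0//= (@le_trans _ _ (M / b)%R) ?lerDr//.
  apply: ler_pM => //; [exact: ltW|by rewrite invr_ge0 ltW|].
  by rewrite lef_pV2 ?posrE.
- rewrite ltr_pdivlMr// (le_lt_trans _ Mr)// exprSr -!mulrA.
  by rewrite ler_wpM2l ?exprn_ge0 ?(ltW a0)// mulrC ler_wpM2r// ltW.
exists (c i * rho)%R, (f i \o g); split.
- by rewrite [leRHS]mulrC -ler_pdivrMr// -mulrA.
- by move=> y z; rewrite /= fi grho mulrA.
- move=> y Ky /=; rewrite -fx' fi mulrC -ltr_pdivlMr//; exact: gK.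
- move=> A mA muA; rewrite comp_preimage; apply: gnull.
    by apply: borel_continuous => //; apply: similarity_continuous fi; exact: ltW.
  exact: self_similar_system_preimage_null.
Qed.

(** Were the ball null, its preimage under a similarity sending [K] into it would be null, yet that
    preimage contains [K]. *)
Lemma self_similar_measure_ball_gt0 (x : V) (r : R) : K x -> (0 < r)%R ->
  0 < mu (ball x r).
Proof.
move=> Kx r0; have [kappa kappa0 copy] := similar_copy_in_ball.
have mb e : measurable (ball x e : set (borel V)).
  by apply: borel_open; exact: ball_open.
have r10 : (0 < Num.min r 1 <= 1)%R by rewrite lt_min r0 ltr01 ge_min lexx orbT.
have [rho [g [rhor grho gK gnull]]] := copy x (Num.min r 1)%R Kx r10.
rewrite lt_neqAle measure_ge0 andbT; apply/eqP => mu0.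
have mr1 : mu (ball x (Num.min r 1)%R) = 0.
  apply/eqP; rewrite eq_le measure_ge0 andbT mu0 le_measure ?inE//.
  by apply: le_ball; rewrite ge_min lexx.
have := gnull _ (mb _) mr1; apply/eqP.
rewrite gt_eqF// (@lt_le_trans _ _ (mu K))//.
  by rewrite self_similar_measure_attractor.
apply: le_measure; rewrite ?inE.
- exact: borel_closed attractor_closed.
- apply: borel_continuous => //; apply: similarity_continuous grho.
  apply: le_trans rhor; rewrite mulr_ge0 ?(ltW kappa0)//.
  by case/andP: r10 => /ltW.
- by move=> y Ky; apply: gK; exists y.
Qed.

End SelfSimilarSystem.

(** The attractor is the support of [mu]: it is closed, of full measure, and balls centered on it
    have positive measure. Constants built from one system therefore depend on [mu] only. *)
Lemma self_similar_attractor_unique {R : realType} {d m m' : nat}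
    (f : 'I_m -> 'rV[R]_d -> 'rV[R]_d) (f' : 'I_m' -> 'rV[R]_d -> 'rV[R]_d)
    (K K' : set 'rV[R]_d) (mu : probability (borel 'rV[R]_d) R) :
  self_similar_system f K mu -> self_similar_system f' K' mu -> K = K'.
Proof.
suff sub n n' (g : 'I_n -> 'rV[R]_d -> 'rV[R]_d) (g' : 'I_n' -> 'rV[R]_d -> 'rV[R]_d)
    (L L' : set 'rV[R]_d) : self_similar_system g L mu ->
    self_similar_system g' L' mu -> L `<=` L'.
  by move=> sK sK'; apply/seteqP; split; [exact: sub sK sK'|exact: sub sK' sK].
move=> sL sL' x Lx; apply: contrapT => L'x.
have cL' := attractor_closed sL'.
have : nbhs x (~` L') by apply: open_nbhs_nbhs; split => //; exact: closed_openC.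
move=> /nbhs_ballP[e /= e0 eL'].
have := self_similar_measure_ball_gt0 sL Lx e0; apply/negP; rewrite -leNgt.
have mL' := borel_closed cL'.
rewrite -(subee (x := 1))// -[X in _ - X](self_similar_measure_attractor sL').
rewrite -probability_setC//; apply: le_measure; rewrite ?inE//.
- by apply: borel_open; exact: ball_open.
- exact: measurableC.
Qed.

(** * Content estimates *)

Section ContentEstimates.
Context {R : realType} {d m : nat}.
Context (f : 'I_m -> 'rV[R]_d -> 'rV[R]_d) (K : set 'rV[R]_d).
Context (mu : probability (borel 'rV[R]_d) R) (D : R).
Context (hd : (0 < d)%N) (sys : self_similar_system f K mu).
Context (hD : exact_dimensional mu D).

Let V := 'rV[R]_d.

(* A similarity [g] maps [K] into [ball x r], so [E] fills [g^-1(E)] up to a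
   null set; the part of it in a Frostman set is covered by the sets
   [g^-1(L_n)], whose diameters are those of [L_n] up to a factor [1/r]. *)
Lemma ball_cover_lower_bound (s : R) : (0 <= s)%R -> (s < D)%R ->
  exists2 c : R, (0 < c)%R &
    forall (x : V) (r : R) (E : set V) J (z : nat -> V) rho,
      K x -> (0 < r <= 1)%R -> measurable (E : set (borel V)) ->
      mu (ball x r `\` E) = 0 -> ball_cover (E `&` ball x r) J z rho ->
      (c * r `^ s)%:E <= \esum_(n in J) diam (closed_ball (z n) (rho n)) `^ s.
Proof.
move=> s0 sD; have [u u1] := @rV_unit_vector R d hd.
have [G [C [cG G0 C0 frost]]] := exact_dimensional_frostman hD s0 sD.
have [kappa kappa0 copy] := similar_copy_in_ball sys.
have mG := borel_closed cG; have mK := borel_closed (attractor_closed sys).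
have Gfin : mu G \is a fin_num by exact: fin_num_measure.
have fG0 : (0 < fine (mu G))%R by rewrite fine_gt0// G0 ltey_eq Gfin.
pose N : R := Num.sqrt d%:R.
have N0 : (0 < N)%R by rewrite sqrtr_gt0 ltr0n.
pose k := (C * (N / kappa) `^ s)%R.
have k0 : (0 < k)%R by rewrite mulr_gt0// powR_gt0 ?divr_gt0.
exists (fine (mu G) / k)%R; first by rewrite divr_gt0.
move=> x r E J z rho Kx r01 mE muE [rho0 cov].
have r0 : (0 < r)%R by case/andP: r01.
have [c [g [rc gc gK gnull]]] := copy x r Kx r01.
have c0 : (0 < c)%R by apply: lt_le_trans rc; rewrite mulr_gt0.
have cg : continuous g by apply: similarity_continuous gc; exact: ltW.
have mb : measurable (ball x r : set (borel V)).
  by apply: borel_open; exact: ball_open.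
have mL n : measurable (g @^-1` closed_ball (z n) (rho n) : set (borel V)).
  by apply: borel_continuous => //; apply: borel_closed; exact: closed_ball_closed.
(* Outside the null set [Z], points are sent by [g] into [E], hence into the cover. *)
pose Z : set (borel V) := ~` K `|` g @^-1` (ball x r `\` E).
have mgE : measurable (g @^-1` (ball x r `\` E) : set (borel V)).
  by apply: borel_continuous => //; exact: measurableD.
have mZ : measurable Z by apply: measurableU => //; exact: measurableC.
have muZ : mu Z = 0.
  apply/negligibleP => //; apply: negligibleU; apply/negligibleP => //.
  - exact: measurableC.
  - apply: (etrans (probability_setC mu mK)).
    by rewrite (self_similar_measure_attractor sys) subee.
  - by apply: gnull => //; exact: measurableD.
pose F n : set (borel V) :=
  if n \in J then g @^-1` closed_ball (z n) (rho n) `&` G else set0.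
have mF n : measurable (F n).
  by rewrite /F; case: ifPn => // _; exact: measurableI.
have GF : mu G <= \sum_(n <oo) mu (F n).
  rewrite (measureDI mu mG mZ) [X in _ + X](_ : _ = 0) ?adde0; last first.
    apply: subset_measure0 (measurableI _ _ mG mZ) mZ _ muZ.
    exact: subIsetr.
  apply: measure_sigma_subadditive => //; first exact: measurableD.
  move=> y [Gy /not_orP[/contrapT Ky gyE]].
  have gyb : ball x r (g y) by apply: gK; exists y.
  have [n Jn Ln] := cov (g y) (conj (contrapT (fun nE => gyE (conj gyb nE))) gyb).
  by exists n => //; rewrite /F ifT ?inE.
have muF n : J n ->
    mu (F n) <= (k * r^-1 `^ s)%:E * diam (closed_ball (z n) (rho n)) `^ s.
  move=> Jn; have rn0 := rho0 _ Jn.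
  rewrite (diam_closed_ball _ u1)// poweR_EFin -EFinM.
  rewrite /F ifT ?inE//.
  have [->|/set0P[y [Ly Gy]]] :=
      eqVneq (g @^-1` closed_ball (z n) (rho n) `&` G) set0.
    by rewrite measure0 lee_fin !mulr_ge0 ?powR_ge0// ltW.
  have rn2 : (0 < 2 * rho n)%R by rewrite mulr_gt0.
  (* [N] is the cost of passing between the sup and Euclidean norms. The preimage of the ball lies
     in this ball around any of its points; taking [y] in [G] makes the Frostman bound available. *)
  apply: (@le_trans _ _ (mu (closed_ball y (N * (2 * rho n) / c)))).
    apply: le_measure; rewrite ?inE.
    - exact: measurableI.
    - by apply: borel_closed; exact: closed_ball_closed.
    move=> y' [Ly' _].
    rewrite closed_ballE ?divr_gt0 ?mulr_gt0// /closed_ball_ /=.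
    apply: le_trans (mx_norm_le_eucl_norm _) _.
    rewrite ler_pdivlMr// mulrC -gc; apply: le_trans (eucl_norm_le_mx_norm _) _.
    rewrite ler_wpM2l ?(ltW N0)//.
    move: Ly Ly'; rewrite /= closed_ballE// /closed_ball_ /= => Ly Ly'.
    by have := ler_distD (z n) (g y) (g y'); rewrite (distrC (g y) (z n)); lra.
  apply: le_trans (frost _ _ Gy _) _; first by rewrite divr_gt0 ?mulr_gt0.
  rewrite lee_fin; set w := (2 * rho n)%R.
  have Nk0 : (0 <= N / kappa)%R by rewrite divr_ge0// ltW.
  have rw0 : (0 <= r^-1 * w)%R by rewrite mulr_ge0// ?invr_ge0 ltW.
  apply: (@le_trans _ _ (C * (N / kappa * (r^-1 * w)) `^ s)%R); last first.
    have r10 : (0 <= r^-1)%R by rewrite invr_ge0 ltW.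
    by rewrite (powRM _ Nk0 rw0) (powRM _ r10 (ltW rn2)) /k !mulrA.
  rewrite ler_pM2l//; apply: ler_powR_base => //.
    by rewrite divr_ge0 ?mulr_ge0// ltW.
  have -> : (N / kappa * (r^-1 * w) = N * w * (kappa * r)^-1)%R.
    by rewrite invfM; ring.
  by rewrite ler_pM2l ?mulr_gt0// lef_pV2 ?posrE// mulr_gt0.
have kr0 : (0 < k * r^-1 `^ s)%R by rewrite mulr_gt0// powR_gt0 ?invr_gt0.
have {}GF : mu G <= (k * r^-1 `^ s)%:E *
    \esum_(n in J) diam (closed_ball (z n) (rho n)) `^ s.
  apply: (le_trans GF); rewrite nneseries_esumT; last by move=> n; exact: measure_ge0.
  apply: le_trans (esumZl_le _ _ _); last 2 first.
  - by rewrite lee_fin ltW.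
  - by move=> n; exact: poweR_ge0.
  rewrite [leRHS]esum_mkcond; apply: le_esum => n _.
  case: ifPn => [/set_mem|/negbTE nJ]; first exact: muF.
  by rewrite /F nJ measure0.
rewrite -lee_pdivrMl// in GF; apply: le_trans GF.
rewrite -[X in _ * X](fineK Gfin) -EFinM lee_fin (invfM k).
have rs : (r^-1 `^ s * r `^ s = 1)%R.
  by rewrite -powRM ?invr_ge0 ?(ltW r0)// mulVf ?gt_eqF// powR1.
have rs0 : (r^-1 `^ s)%R != 0%R by rewrite gt_eqF// powR_gt0 ?invr_gt0.
rewrite (_ : (r^-1 `^ s)^-1 = r `^ s)%R; last first.
  by apply: (mulfI rs0); rewrite rs divff.
by rewrite le_eqVlt; apply/orP; left; apply/eqP; ring.
Qed.

(* A point of [K] in [Omega] either lies in some [2 L_n], or has a small ball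
   [ball x t] in [Omega] met only by [L_n] of radius less than [t], hence
   centered in [ball x (3 t)]; the lower bound in [ball x t] then controls the
   contribution of these balls in a disjoint subfamily. *)
Lemma hausdorff_content_attractor_le (s : R) : (0 <= s)%R -> (s < D)%R ->
  exists2 C : R, (0 < C)%R &
    forall (Omega E : set V) J (z : nat -> V) rho, open Omega ->
      measurable (E : set (borel V)) -> mu (Omega `\` E) = 0 ->
      ball_cover E J z rho ->
      hausdorff_content s (Omega `&` K)
        <= C%:E * \esum_(n in J) diam (closed_ball (z n) (rho n)) `^ s.
Proof.
move=> s0 sD; have [u u1] := @rV_unit_vector R d hd.
have [c c0 lower] := ball_cover_lower_bound s0 sD.
(* [2 ^ s] pays for doubling the cover, [6 ^ s] for the Vitali step, [3 ^ s] for using radii [3 t x]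
   there, and [1 / c] for the lower bound in balls. *)
exists (2 `^ s + 6 `^ s * (3 `^ s / c))%R.
  by rewrite addr_gt0 ?powR_gt0// mulr_gt0 ?powR_gt0// divr_gt0 ?powR_gt0.
move=> Omega E J z rho oO mE muE [rho0 cov].
pose P1 := (Omega `&` K) `&` \bigcup_(n in J) closed_ball (z n) (2 * rho n).
pose P2 := (Omega `&` K) `\` P1.
have P12 : Omega `&` K `<=` P1 `|` P2.
  by move=> x OKx; have [P1x|nP1x] := pselect (P1 x); [left|right].
apply: (le_trans (hausdorff_content_le s P12)).
apply: (le_trans (hausdorff_contentU s P1 P2)).
rewrite EFinD ge0_muleDl ?lee_fin ?mulr_ge0 ?invr_ge0 ?powR_ge0 ?(ltW c0)//.
apply: leeD.
  apply: (le_trans (@hausdorff_content_le_esum R V s P1 _ J z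
    (fun n => 2 * rho n)%R (countableP _) _ _)).
  - by move=> n Jn; rewrite mulr_gt0// rho0.
  - by move=> x [].
  apply: le_trans (esumZl_le _ _ _); last 2 first.
  - by rewrite lee_fin powR_ge0.
  - by move=> n; exact: poweR_ge0.
  apply: le_esum => n Jn; have rn0 := rho0 _ Jn.
  rewrite !(diam_closed_ball _ u1)// ?mulr_gt0// !poweR_EFin -EFinM -powRM//.
  by rewrite mulr_ge0// ltW.
have /choice[t tP2] : forall x, exists t : R, P2 x ->
    (0 < t <= 1)%R /\ ball x t `<=` Omega.
  move=> x; have [P2x|nP2x] := pselect (P2 x); last by exists 0%R.
  have Ox : Omega x by case: P2x => -[].
  have /nbhs_ballP[e /= e0 eO] : nbhs x Omega by exact: open_nbhs_nbhs.
  exists (Num.min e 1)%R => _; split.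
    by rewrite lt_min e0 ltr01 ge_min lexx orbT.
  by apply: subset_trans eO; apply: le_ball; rewrite ge_min lexx.
rewrite EFinM -muleA.
apply: (@hausdorff_content_packing _ _ u s P2 (fun x => 3 * t x)%R 3%R) => //.
  move=> x /tP2[/andP[t0 t1] _]; rewrite mulr_gt0//=.
  by rewrite -[leRHS]mulr1 ler_pM2l.
move=> F FP2 tF.
pose Jx x := [set n | J n /\ closed_ball (z n) (rho n) `&` ball x (t x) !=set0].
(* A center farther away would force [rho n > 2 t x] and put [x] in the doubled ball. Disjointness
   of the balls of radius [3 t x] then makes the [Jx x] disjoint. *)
have small x n : F x -> Jx x n -> ball x (3 * t x) (z n).
  move=> Fx [Jn [w [Lw]]]; have := FP2 _ Fx => -[OKx nP1x].
  have rn0 := rho0 _ Jn.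
  move: Lw; rewrite closed_ballE// -!ball_normE /closed_ball_ /ball_ /= => zw xw.
  rewrite ltNge; apply/negP => far; apply: nP1x; split => //; exists n => //.
  rewrite closed_ballE ?mulr_gt0// /closed_ball_ /=.
  by have := ler_distD w x (z n); rewrite (distrC w (z n)) (distrC (z n) x); lra.
apply: (@le_trans _ _ ((3 `^ s / c)%:E * \esum_(x in F) \esum_(n in Jx x)
    diam (closed_ball (z n) (rho n)) `^ s)); last first.
  apply: lee_wpmul2l; first by rewrite lee_fin divr_ge0 ?powR_ge0// ltW.
  apply: esum_trivIset_le => [x y Fx Fy [n [Jxn Jyn]]|x _ n []//|n].
    by apply: tF => //; exists (z n); split; exact: small.
  exact: poweR_ge0.
apply: le_trans (esumZl_le _ _ _); last 2 first.
- by rewrite lee_fin divr_ge0 ?powR_ge0// ltW.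
- by move=> x; apply: esum_ge0 => n _; exact: poweR_ge0.
apply: le_esum => x Fx; have [t01 tO] := tP2 _ (FP2 _ Fx).
have [t0 _] := andP t01.
have Kx : K x by case: (FP2 _ Fx) => -[].
have := lower x (t x) E (Jx x) z rho Kx t01 mE.
have muEt : mu (ball x (t x) `\` E) = 0.
  have mb : measurable (ball x (t x) : set (borel V)).
    by apply: borel_open; exact: ball_open.
  apply: subset_measure0 muE; [exact: measurableD| |exact: setSD].
  by apply: measurableD => //; exact: borel_open.
move=> /(_ muEt) low.
apply: (@le_trans _ _ ((3 `^ s / c)%:E * (c * t x `^ s)%:E)).
  by rewrite -EFinM lee_fin powRM ?(ltW t0)// mulrA divfK// gt_eqF.
apply: lee_wpmul2l; first by rewrite lee_fin divr_ge0 ?powR_ge0// ltW.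
apply: low; split; first by move=> n [Jn _]; exact: rho0.
move=> y [Ey xy]; have [n Jn Ly] := cov _ Ey.
by exists n => //; split => //; exists y.
Qed.

(** At a typical point and for [r < 1], both logarithms are nonpositive, also under the convention
    [ln 0 = 0]. Thus [D < s] gives the [0 <= s] that the packing bound requires. *)
Lemma exact_dimension_ge0 : (0 <= D)%R.
Proof.
rewrite leNgt; apply/negP => D0.
have [x nx] : exists x : borel V, (ln (fine (mu (closed_ball (x : V) r))) / ln r)%R
    @[r --> (0%R : R)^'+] --> D.
  apply: contrapT => /forallNP nD.
  have negT : mu.-negligible (setT : set (borel V)).
    by apply: negligibleS hD => x _ /=; exact: nD.
  have := proj1 (negligibleP mu measurableT) negT.
  by rewrite /= probability_setT => /eqP; rewrite onee_eq0.
have [e e0 he] := near_right0 (cvgr_lt _ nx _ D0).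
pose r : R := Num.min (e / 2)%R (1 / 2)%R.
have r0 : (0 < r)%R by rewrite lt_min !divr_gt0.
have re : (r < e)%R by rewrite gt_min ltr_pdivrMr// ltr_pMr// ltr1n.
have r1 : (r < 1)%R by rewrite gt_min [X in _ || X]ltr_pdivrMr// mul1r ltr1n orbT.
have := he r; rewrite r0 re => /(_ isT); rewrite ltNge => /negP; apply.
have lnr : (ln r < 0)%R by rewrite ln_lt0// r0.
apply: mulr_le0; last by rewrite invr_le0 ltW.
apply: ln_le0; rewrite -lee_fin fineK.
  by apply: probability_le1; apply: borel_closed; exact: closed_ball_closed.
by apply: fin_num_measure; apply: borel_closed; exact: closed_ball_closed.
Qed.

(** For [s'] strictly between [D] and [s], small balls satisfy [r ^ s <= eps ^ (s - s') * mu B].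
    Summed over a disjoint family, this is at most [eps ^ (s - s')], which is arbitrarily small. *)
Lemma hausdorff_content_local_dimension_eq0 (s : R) (E : set V) : (D < s)%R ->
  E `<=` K -> (forall x, E x -> (ln (fine (mu (closed_ball x r))) / ln r)%R
    @[r --> (0%R : R)^'+] --> D) ->
  hausdorff_content s E = 0.
Proof.
move=> Ds EK ED; have [u u1] := @rV_unit_vector R d hd.
have s0 : (0 <= s)%R by rewrite (le_trans exact_dimension_ge0)// ltW.
pose s' := ((D + s) / 2)%R.
have Ds' : (D < s')%R by rewrite /s'; lra.
have s's : (0 < s - s')%R by rewrite /s'; lra.
apply/eqP; rewrite eq_le hausdorff_content_ge0 andbT.
apply/lee_addgt0Pr => e e0; rewrite add0e.
pose k : R := (6 `^ s * 2 `^ s)%R.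
have k0 : (0 < k)%R by rewrite mulr_gt0 ?powR_gt0.
(* [1 / 2] keeps [ln r] negative; the other bound gives [k * eps ^ (s - s') <= e]. *)
pose eps : R := Num.min (1 / 2)%R ((e / k) `^ (s - s')^-1)%R.
have eps0 : (0 < eps)%R by rewrite lt_min divr_gt0//= powR_gt0// divr_gt0.
have eps1 : (eps < 1)%R by rewrite gt_min ltr_pdivrMr// mul1r ltr1n.
have epse : (k * eps `^ (s - s') <= e)%R.
  rewrite -ler_pdivlMl// mulrC.
  apply: (@le_trans _ _ (((e / k) `^ (s - s')^-1) `^ (s - s'))%R).
    by apply: ler_powR_base; [exact: ltW|exact: ltW|rewrite ge_min lexx orbT].
  by rewrite -powRrM mulVf ?gt_eqF// powRr1// divr_ge0// ltW.
have mb (x : V) r : measurable (ball x r : set (borel V)).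
  by apply: borel_open; exact: ball_open.
have mcb (x : V) r : measurable (closed_ball x r : set (borel V)).
  by apply: borel_closed; exact: closed_ball_closed.
have /choice[r rE] : forall x, exists r : R, E x -> (0 < r <= eps)%R /\
    (r `^ s')%:E <= mu (ball x (2 * r)).
  move=> x; have [Ex|nEx] := pselect (E x); last by exists 0%R.
  have [a a0 ha] := near_right0 (cvgr_lt _ (ED _ Ex) _ Ds').
  pose r : R := Num.min (a / 2)%R eps.
  have r0 : (0 < r)%R by rewrite lt_min divr_gt0.
  have ra : (r < a)%R by rewrite gt_min ltr_pdivrMr// ltr_pMr// ltr1n.
  have reps : (r <= eps)%R by rewrite ge_min lexx orbT.
  have lnr : (ln r < 0)%R by rewrite ln_lt0// r0 (le_lt_trans reps).
  exists r => _; split; first by rewrite r0.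
  have := ha r; rewrite r0 ra => /(_ isT); rewrite ltr_ndivrMr// => lnm.
  apply: (@le_trans _ _ (mu (closed_ball x r))); last first.
    apply: le_measure; rewrite ?inE; [exact: mcb|exact: mb|].
    apply: closed_ball_subset => //; lra.
  have mfin : mu (closed_ball x r) \is a fin_num by exact: fin_num_measure.
  (* Positivity, due to [x] being in [K], excludes the value [ln 0 = 0], for which the logarithmic
     inequality would say nothing about the measure. *)
  have m0 : (0 < fine (mu (closed_ball x r)))%R.
    rewrite fine_gt0// ltey_eq mfin andbT.
    apply: (lt_le_trans (self_similar_measure_ball_gt0 sys (EK _ Ex) r0)).
    apply: le_measure; rewrite ?inE; [exact: mb|exact: mcb|].
    exact: subset_closed_ball.
  rewrite -[leRHS](fineK mfin) lee_fin ltW//.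
  by rewrite -ltr_ln ?posrE ?powR_gt0// ln_powR.
apply: (@le_trans _ _ ((6 `^ s)%:E * (2 `^ s * eps `^ (s - s'))%:E)); last first.
  by rewrite -EFinM lee_fin mulrA.
apply: (@hausdorff_content_packing _ _ u s E (fun x => 2 * r x)%R 2%R) => //.
  move=> x /rE[/andP[r0 r1] _]; rewrite mulr_gt0//= -[leRHS]mulr1 ler_pM2l//.
  by rewrite (le_trans r1)// ltW.
move=> F FE tF.
apply: (@le_trans _ _ ((2 `^ s * eps `^ (s - s'))%:E *
    \esum_(x in F) mu (ball x (2 * r x)))); last first.
  rewrite -[leRHS]mule1; apply: lee_wpmul2l.
    by rewrite lee_fin mulr_ge0 ?powR_ge0.
  exact: esum_trivIset_probability.
apply: le_trans (esumZl_le _ _ _); last 2 first.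
- by rewrite lee_fin mulr_ge0 ?powR_ge0.
- by move=> x; exact: measure_ge0.
apply: le_esum => x /FE/rE[/andP[r0 reps] mur].
apply: le_trans (lee_wpmul2l _ mur); last by rewrite lee_fin mulr_ge0 ?powR_ge0.
rewrite -EFinM lee_fin powRM ?(ltW r0)// -mulrA ler_pM2l ?powR_gt0//.
have -> : (r x `^ s = r x `^ (s - s') * r x `^ s')%R.
  by rewrite -powRD ?subrK// (gt_eqF r0) implybT.
rewrite ler_pM2r ?powR_gt0//.
by apply: ler_powR_base => //; exact: ltW.
Qed.

End ContentEstimates.

(** * Essential content of balls and open sets *)

Lemma essential_content_ball_le {R : realType} {V : normedModType R}
    (mu : {measure set (borel V) -> \bar R}) (s : R) (x : V) (r : R) :
  (0 < r)%R ->
  essential_content mu s (closed_ball x r) <= diam (closed_ball x r) `^ s.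
Proof.
move=> r0; apply: (@le_trans _ _ (hausdorff_content s (closed_ball x r))).
  apply: ereal_inf_lbound; exists (closed_ball x r) => //; split => //.
  by apply: borel_closed; exact: closed_ball_closed.
apply: ereal_inf_lbound; exists [set 0%N], (fun=> x), (fun=> r); split.
  by split => // y xy; exists 0%N.
by rewrite esum_set1//; exact: poweR_ge0.
Qed.

Lemma measure_attractorI {R : realType} {d m : nat}
    (f : 'I_m -> 'rV[R]_d -> 'rV[R]_d) (K : set 'rV[R]_d)
    (mu : probability (borel 'rV[R]_d) R) (A : set (borel 'rV[R]_d)) :
  self_similar_system f K mu -> measurable A -> mu (A `&` K) = mu A.
Proof.
move=> sys mA; have mK := borel_closed (attractor_closed sys).
rewrite [RHS](measureDI mu mA mK) [X in X + _](_ : _ = 0) ?add0e//.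
apply: (subset_measure0 (measurableD mA mK) (measurableC mK)); first exact: subDsetr.
apply: (etrans (probability_setC mu mK)).
by rewrite (self_similar_measure_attractor sys) subee.
Qed.

Theorem theorem2p6 (R : realType) (d : nat) (hd : (0 < d)%N)
    (mu : probability (borel 'rV[R]_d) R)
    (D : R) (hD : exact_dimensional mu D) :
  (forall s : R, (0 <= s)%R -> (s < D)%R ->
    exists c : R, (0 < c)%R /\
      forall (m : nat) (f : 'I_m -> 'rV[R]_d -> 'rV[R]_d) (K : set 'rV[R]_d),
      self_similar_system f K mu ->
      (forall (x : 'rV[R]_d) (r : R), K x -> (0 < r)%R -> (r <= 1)%R ->
        let B := closed_ball x r in
        [/\ c%:E * (diam B `^ s) <= essential_content mu s (B°),
            essential_content mu s (B°) <= essential_content mu s B &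
            essential_content mu s B <= diam B `^ s])
      /\
      (forall Omega : set 'rV[R]_d, open Omega ->
        c%:E * hausdorff_content s (Omega `&` K)
          <= essential_content mu s Omega
        /\ essential_content mu s Omega
          <= hausdorff_content s (Omega `&` K)))
  /\
  (forall s : R, (D < s)%R ->
    forall (m : nat) (f : 'I_m -> 'rV[R]_d -> 'rV[R]_d) (K : set 'rV[R]_d),
    self_similar_system f K mu ->
    forall Omega : set 'rV[R]_d, open Omega ->
      essential_content mu s Omega = 0).
Proof.
have [u u1] := @rV_unit_vector R d hd.
split=> [s s0 sD|s Ds m f K sys Omega oO].
  (* The attractor is determined by [mu], so any system carrying [mu] provides
     the constant for all of them. *)
  have [[m0 [f0 [K0 sys0]]]|nosys] := pselect (exists m
      (f : 'I_m -> 'rV[R]_d -> 'rV[R]_d) K, self_similar_system f K mu); last first.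
    exists 1%R; split => // m f K sys; exfalso; apply: nosys.
    by exists m, f, K.
  have [c c0 lower] := ball_cover_lower_bound hd sys0 hD s0 sD.
  have [C C0 upper] := hausdorff_content_attractor_le hd sys0 hD s0 sD.
  (* The first term serves balls, whose diameter is [2 r]; the second serves open sets. *)
  have c'0 : (0 < Num.min (c / 2 `^ s) C^-1)%R.
    by rewrite lt_min invr_gt0 C0 andbT divr_gt0// powR_gt0.
  exists (Num.min (c / 2 `^ s) C^-1)%R; split => // m f K sys.
  rewrite (self_similar_attractor_unique sys sys0).
  split=> [x r Kx r0 r1 B|Omega oO].
    have oB : open (ball x r) by exact: ball_open.
    have mB := borel_open oB.
    have mcB := borel_closed (@closed_ball_closed R _ x r).
    have -> : B° = ball x r by exact: interior_closed_ballE.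
    split; last exact: essential_content_ball_le.
    - apply: le_ereal_inf_tmp => _ [E [EB mE muE] <-].
      apply: le_ereal_inf_tmp => _ [J [z [rho [[rho0 cov] ->]]]].
      have r01 : (0 < r <= 1)%R by rewrite r0.
      apply: le_trans (lower x r E J z rho Kx r01 mE _ _).
      + rewrite /B (diam_closed_ball _ u1)// poweR_EFin -EFinM lee_fin.
        rewrite powRM ?(ltW r0)// mulrA ler_pM2r ?powR_gt0//.
        by rewrite -ler_pdivlMr ?powR_gt0// ge_min lexx.
      + exact: (measure_setD_eq0 mB mE EB muE).
      + by split => // y [Ey _]; exact: cov.
    - by apply: essential_content_le => //; exact: subset_closed_ball.
  split.
    apply: le_ereal_inf_tmp => _ [E [EO mE muE] <-].
    apply: le_ereal_inf_tmp => _ [J [z [rho [cov ->]]]].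
    have muOE := measure_setD_eq0 (borel_open oO) mE EO muE.
    have := upper Omega E J z rho oO mE muOE cov.
    rewrite -lee_pdivrMl//; apply: le_trans; apply: lee_wpmul2r.
      exact: hausdorff_content_ge0.
    by rewrite lee_fin ge_min lexx orbT.
  (* This set competes in the infimum because [K0] has full measure. *)
  apply: ereal_inf_lbound; exists (Omega `&` K0) => //; split.
  - exact: subIsetl.
  - apply: measurableI; first exact: borel_open.
    exact: borel_closed (attractor_closed sys0).
  - by apply: (measure_attractorI sys0); exact: borel_open.
apply/eqP; rewrite eq_le; apply/andP; split; last first.
  by apply: le_ereal_inf_tmp => _ [E _ <-]; exact: hausdorff_content_ge0.
have [N [mN muN DN]] := hD.
have mO := borel_open oO; have mK := borel_closed (attractor_closed sys).
have mOK : measurable (Omega `&` K : set (borel 'rV[R]_d)) by exact: measurableI.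
(* Removing the null set [N] leaves points of [K] where the local dimension is [D]; what remains
   still has the measure of [Omega]. *)
have <- : hausdorff_content s ((Omega `&` K) `\` (N : set 'rV[R]_d)) = 0.
  apply: (hausdorff_content_local_dimension_eq0 hd sys hD Ds).
    by move=> x [[]].
  by move=> x [_ nN]; apply: contrapT => nx; apply: nN; exact: DN.
apply: ereal_inf_lbound; exists ((Omega `&` K) `\` (N : set 'rV[R]_d)) => //; split.
- by move=> x [[]].
- exact: measurableD.
apply: etrans (measure_attractorI sys mO).
rewrite [RHS](measureDI mu mOK mN).
rewrite [X in _ + X](_ : _ = 0) ?adde0//.
apply: subset_measure0 (measurableI _ _ mOK mN) mN _ muN.
exact: subIsetr.
Qed.
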